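(* Let $k$ be a field. The class of tame thin sums matroids over $k$ is closed under duality and under taking minors. That is, if $M$ is a tame thin sums matroid over $k$, then $M^*$ is a tame thin sums matroid over $k$, and every minor $M/C\backslash D$ of $M$ (with $C$, $D$ disjoint subsets of the ground set) is a tame thin sums matroid over $k$.
   Context: A matroid $M$ consists of a (possibly infinite) ground set $E$ and a set $\mathcal I$ of subsets of $E$ (the independent sets) such that: (I1) $\emptyset\in\mathcal I$; (I2) $\mathcal I$ is closed under taking subsets; (I3) for every non-maximal $I\in\mathcal I$ and every maximal $I'\in\mathcal I$ there is $x\in I'\setminus I$ with $I\cup\{x\}\in\mathcal I$; (IM) whenever $I\subseteq X\subseteq E$ and $I\in\mathcal I$, the set $\{I'\in\mathcal I : I\subseteq I'\subseteq X\}$ has a maximal element. Bases are maximal independent sets; circuits are minimal dependent (non-independent) sets. The dual $M^*$ is the matroid on $E$ whose bases are the complements of the bases of $M$; cocircuits of $M$ are circuits of $M^*$. Deletion: $M\backslash D$ is the matroid on $E\setminus D$ whose independent sets are the independent sets of $M$ contained in $E\setminus D$. Contraction: $M/C=(M^*\backslash C)^*$. A matroid is tame if the intersection of any circuit with any cocircuit is finite. Thin sums: for a set $A$ and a map $f\colon E\to k^A$, a thin dependence of $f$ is a map $c\colon E\to k$ such that for each $a\in A$ we have $\sum_{e\in E}c(e)f(e)(a)=0$ (including the requirement that, for each $a$, only finitely many summands are nonzero). The thin sums system $M_{ts}(f)$ is the set system on $E$ in which a subset is independent iff there is no nonzero thin dependence of $f$ that is zero outside that subset. A matroid $M$ on $E$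 is a thin sums matroid over $k$ if $M=M_{ts}(f)$ for some set $A$ and some $f\colon E\to k^A$. *)

(* Defs.v *)
From mathcomp Require Import all_boot all_algebra.
From mathcomp Require Import boolp classical_sets functions cardinality fsbigop.

Set Implicit Arguments.
Unset Strict Implicit.
Unset Printing Implicit Defensive.

Import GRing.Theory.
Local Open Scope classical_set_scope.
Local Open Scope ring_scope.

(* Ground sets are subsets of an ambient type, so that a matroid and all its
   minors live over the same type. *)
Record setsys (T : Type) := SetSys {
  ground : set T;
  indep : set (set T)
}.

Definition maximal_in (T : Type) (F : set (set T)) (X : set T) : Prop :=
  F X /\ forall Y, F Y -> X `<=` Y -> Y = X.

Definition minimal_in (T : Type) (F : set (set T)) (X : set T) : Prop :=
  F X /\ forall Y, F Y -> Y `<=` X -> Y = X.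

Record is_matroid (T : Type) (M : setsys T) : Prop := IsMatroid {
  indep_ground : forall I, indep M I -> I `<=` ground M;
  indep_set0 : indep M set0;
  indep_sub : forall I J, indep M J -> I `<=` J -> indep M I;
  indep_augment : forall I J,
    indep M I -> ~ maximal_in (indep M) I -> maximal_in (indep M) J ->
    exists x, (J `\` I) x /\ indep M (I `|` [set x]);
  indep_maximal : forall I X,
    indep M I -> I `<=` X -> X `<=` ground M ->
    exists J, maximal_in [set K | [/\ indep M K, I `<=` K & K `<=` X]] J
}.

Definition base (T : Type) (M : setsys T) : set (set T) :=
  maximal_in (indep M).

Definition circuit (T : Type) (M : setsys T) : set (set T) :=
  minimal_in [set X | X `<=` ground M /\ ~ indep M X].

(* In a matroid every independent set lies in a base (IM), so the matroid whose
   bases are the complements of the bases of M has the following independent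
   sets. *)
Definition dual (T : Type) (M : setsys T) : setsys T :=
  SetSys (ground M) [set I | exists2 B, base M B & I `<=` ground M `\` B].

Definition cocircuit (T : Type) (M : setsys T) : set (set T) :=
  circuit (dual M).

Definition deletion (T : Type) (M : setsys T) (D : set T) : setsys T :=
  SetSys (ground M `\` D) [set I | indep M I /\ I `<=` ground M `\` D].

Definition contraction (T : Type) (M : setsys T) (C : set T) : setsys T :=
  dual (deletion (dual M) C).

Definition tame (T : Type) (M : setsys T) : Prop :=
  forall C D, circuit M C -> cocircuit M D -> finite_set (C `&` D).

(* A map c : E -> k is represented by its extension by zero to T, and only the
   restriction of f to E matters.  The finiteness condition is not redundant:
   \sum_(e \in E) is 0 by convention on infinite supports. *)
Definition thin_dependence (k : fieldType) (T : choiceType) (E : set T)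
    (A : Type) (f : T -> A -> k) (c : T -> k) : Prop :=
  (forall e, ~ E e -> c e = 0) /\
  forall a, finite_set [set e | E e /\ c e * f e a <> 0] /\
            \sum_(e \in E) (c e * f e a) = 0.

Definition thin_sums (k : fieldType) (T : choiceType) (E : set T)
    (A : Type) (f : T -> A -> k) : setsys T :=
  SetSys E [set I | I `<=` E /\
    ~ exists c : T -> k, [/\ thin_dependence E f c,
                             (exists e, c e <> 0)
                           & forall e, ~ I e -> c e = 0]].

Definition thin_sums_matroid (k : fieldType) (T : choiceType) (M : setsys T) :
    Prop :=
  is_matroid M /\
  exists (A : Type) (f : T -> A -> k), M = thin_sums (ground M) f.

(* Main.v *)
Require Import Defs.
From mathcomp Require Import all_boot all_algebra.
From mathcomp Require Import boolp classical_sets functions cardinality fsbigop.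
Local Open Scope classical_set_scope.

(** A minor M/C\D is obtained from M by dualising, deleting C, dualising and
    deleting D, so it is enough to treat deletion and duality. Deletion is
    harmless for the representation, since the same family f restricted to the
    smaller ground set works ([thin_sums_deletion]), and it preserves tameness
    because every cocircuit of M\D extends to a cocircuit of M
    ([cocircuit_deletion_lift]).

    For duality, let M = M_ts(f) be tame. The dual is represented by the family
    whose coordinates are the thin dependences c of f supported exactly on
    circuits: the e-th vector has c-th coordinate c(e). Thin dependences of this
    family are the vectors d that are orthogonal to every such c.
    - If d is nonzero with support in a coindependent set, then some base B
      avoids that support, and for e with d(e) <> 0 the fundamental circuit of
      e with respect to B meets the support of d in e only; so d is not
      orthogonal to its circuit vector.
    - Conversely a codependent set contains a cocircuit D, and it must be shown
      that D supports a nonzero vector d orthogonal to all circuit vectors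
      ([cocircuit_orthogonal]). Fix e0 in D. For every other x in D there is a
      circuit meeting D in {x, e0} only; this prescribes the ratio d(x) / d(e0).
      Given a circuit vector c, tameness makes its trace on D finite, so
      finitely many of these special vectors cancel c on all of D except e0. The
      result is a thin dependence meeting D in at most e0, and d is orthogonal
      to c exactly when it vanishes at e0 too.

    That last vanishing is the crux: a circuit and a cocircuit never meet in a
    single element, but a thin dependence need not be a circuit vector. It is
    rescued by [circuit_in_support]: each point of the support of a thin
    dependence c lies on a circuit contained in that support. On the support K
    of c every coordinate of f is finitely supported, so it is a condition of
    finite character on a subset Z of K that no vector orthogonal to the thin
    dependences within K be nonzero at e0 and zero on the rest of K minus Z.
    Zorn's lemma gives a maximal such Z, and K minus Z together with e0 is the
    circuit. The dependence supported on it comes from the same cancellation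
    argument as for cocircuits, with the roles of vectors and functionals
    exchanged; [separating_functional] is the common form of both. *)

Set Implicit Arguments.
Unset Strict Implicit.
Unset Printing Implicit Defensive.

Import GRing.Theory.

(** * Bases, fundamental circuits and the dual matroid *)

Section MatroidTheory.
Variables (T : Type) (M : setsys T).
Hypothesis matM : is_matroid M.

Lemma not_maximal_sub (I J : set T) x :
  indep M J -> I `<=` J -> J x -> ~ I x -> ~ maximal_in (indep M) I.
Proof. by move=> iJ IJ Jx nIx [_ /(_ J iJ IJ) JI]; apply: nIx; rewrite -JI. Qed.

Lemma base_indep B : base M B -> indep M B.
Proof. by case. Qed.

Lemma base_ground B : base M B -> B `<=` ground M.
Proof. by move=> /base_indep; apply: indep_ground. Qed.

(** If J is maximal among the independent sets between I and X but not a base,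
    augmenting it from B would stay inside X. *)
Lemma base_extend (B I X : set T) :
  base M B -> B `<=` X -> X `<=` ground M -> indep M I -> I `<=` X ->
  exists J, [/\ base M J, I `<=` J & J `<=` X].
Proof.
move=> bB BX XE iI IX.
have [J [[iJ IJ JX] maxJ]] := indep_maximal matM iI IX XE.
exists J; split=> //; apply: contrapT => nbJ.
have [x [[Bx nJx] iJx]] := indep_augment matM iJ nbJ bB.
apply: nJx; rewrite -(maxJ (J `|` [set x])); [by right| |by move=> y; left].
split=> // [y /IJ|y [/JX|->]]; [by left|by []|exact: BX].
Qed.

Lemma indep_in_base (I : set T) : indep M I -> exists2 B, base M B & I `<=` B.
Proof.
move=> iI.
have [B [[iB IB BE] maxB]] :=
  indep_maximal matM iI (indep_ground matM iI) (@subset_refl _ _).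
exists B => //; split=> // Y iY BY; apply: maxB => //; split=> //.
  exact: subset_trans BY.
exact: indep_ground.
Qed.

Lemma exists_base : exists B, base M B.
Proof. by have [B bB _] := indep_in_base (indep_set0 matM); exists B. Qed.

(** Extend I to a base B: the circuit consists of the y in B + x such that
    removing y from B + x leaves an independent set. Such a y lies in I + x,
    since otherwise that independent set would contain I + x. *)
Lemma fundamental_circuit (I : set T) x :
  indep M I -> ground M x -> ~ indep M (I `|` [set x]) ->
  exists C, [/\ circuit M C, C `<=` I `|` [set x] & C x].
Proof.
move=> iI Ex dIx; have [B bB IB] := indep_in_base iI.
have iB := base_indep bB.
have BxE : B `|` [set x] `<=` ground M.
  by move=> y [|->] //; apply: base_ground.
pose C := [set y | (B `|` [set x]) y /\ indep M ((B `|` [set x]) `\ y)].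
have Cx : C x.
  split; first by right.
  by apply: (indep_sub matM) iB _ => y [[//|->] nxx]; case: nxx.
exists C; split=> //; last first.
  move=> y [[By|->] iy]; last by right.
  have [|nIy] := EM (I y); first by left.
  have [->|nyx] := EM (y = x); first by right.
  case: dIx; apply: (indep_sub matM) iy _ => z [Iz|->].
    by split; [left; apply: IB | move=> zy; apply: nIy; rewrite -zy].
  by split; [right | move=> xy; apply: nyx].
split; last first.
  move=> Y [YE dY] YC; apply/seteqP; split=> // y [Bxy iy].
  apply: contrapT => nYy; apply: dY; apply: (indep_sub matM) iy _ => z Yz.
  by split; [case: (YC z Yz) | move=> zy; apply: nYy; rewrite -zy].
split=> [y [+ _]|iC]; first exact: BxE.
have [J [bJ CJ JBx]] : exists J, [/\ base M J, C `<=` J & J `<=` B `|` [set x]].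
  by apply: (base_extend bB) => // y [].
(* Exchanging y for x in B gives an independent set, so y belongs to C. *)
have [y [By nJy]] : exists y, B y /\ ~ J y.
  apply: contrapT => nex; apply: dIx.
  apply: (indep_sub matM) (base_indep bJ) _ => z [/IB Bz|->]; last exact: CJ.
  by apply: contrapT => nJz; apply: nex; exists z.
have iBy : indep M (B `\ y) by apply: (indep_sub matM) iB _ => z [].
have [|w [[Jw nw] iw]] := indep_augment matM iBy _ bJ.
  by apply: (not_maximal_sub iB _ By) => [z []|[_ /(_ erefl)]].
have wx : w = x.
  case: (JBx w Jw) => // Bw; case: nw; split=> // wy.
  by apply: nJy; rewrite -wy.
apply/nJy/CJ; split; first by left.
apply: (indep_sub matM) iw _ => z [[Bz|->] nzy]; last by right; rewrite wx.
by left.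
Qed.

Lemma dependent_circuit (X : set T) :
  X `<=` ground M -> ~ indep M X -> exists2 C, circuit M C & C `<=` X.
Proof.
move=> XE dX.
have [I [[iI _ IX] maxI]] :=
  indep_maximal matM (indep_set0 matM) (@sub0set _ _) XE.
have [x [Xx nIx]] : exists x, X x /\ ~ I x.
  apply: contrapT => nex; apply: dX; apply: (indep_sub matM) iI _ => z Xz.
  by apply: contrapT => nIz; apply: nex; exists z.
have IxX : I `|` [set x] `<=` X by move=> y [/IX|->].
have [|C [cC CIx _]] := fundamental_circuit iI (XE x Xx); last first.
  by exists C => // y /CIx /IxX.
move=> iIx; apply: nIx; rewrite -(maxI (I `|` [set x])); first by right.
  by split.
by move=> y; left.
Qed.

Lemma base_dual (X : set T) :
  base (dual M) X <-> exists2 B, base M B & X = ground M `\` B.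
Proof.
split=> [[[B bB XB] maxX]|[B bB ->]].
  exists B => //; apply/esym/maxX => //; exists B => //.
split; first by exists B.
move=> Y [B' bB' YB'] BY; apply/seteqP; split=> // y /YB' [Ey nB'y].
split=> // By; apply: nB'y.
suff -> : B' = B by [].
apply/esym; apply: bB'.2; first exact: base_indep.
move=> z B'z; apply: contrapT => nBz.
by have [] := YB' z (BY z (conj (base_ground bB' B'z) nBz)).
Qed.

(** For augmentation, the complement of I contains a base but is dependent, so a
    base extending its intersection with B inside it leaves out an element
    that is not in B. For maximality, take a base B avoiding I that extends a
    maximal independent subset of the complement of X, hence meets X as little
    as possible. *)
Lemma dual_is_matroid : is_matroid (dual M).
Proof.
split.
- by move=> I [B _ IB] y /IB [].
- by have [B bB] := exists_base; exists B.
- by move=> I J [B bB JB] IJ; exists B => // y /IJ /JB.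
- move=> I J [B' bB' IB'] nmaxI /base_dual[B bB ->].
  pose X := ground M `\` I.
  have XE : X `<=` ground M by move=> y [].
  have B'X : B' `<=` X.
    move=> y B'y; split; first exact: base_ground B'y.
    by move=> /IB' [].
  have [J' [bJ' BJ' J'X]] :
      exists J, [/\ base M J, B `&` X `<=` J & J `<=` X].
    apply: (base_extend bB') => //.
    by apply: (indep_sub matM) (base_indep bB) _ => y [].
  have [x [Xx nJx]] : exists x, X x /\ ~ J' x.
    apply: contrapT => nex; apply: nmaxI; apply/base_dual.
    exists J' => //; apply/seteqP; split=> y.
      by move=> Iy; split; [case: (IB' y Iy)|move=> /J'X []].
    move=> [Ey nJ'y]; apply: contrapT => nIy; apply: nex.
    by exists y.
  exists x; split.
    split; last by case: Xx.
    by split; [exact: XE|move=> Bx; apply/nJx/BJ'].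
  exists J' => // y [Iy|->]; last by split=> //; apply: XE.
  by split; [case: (IB' y Iy)|move=> /J'X []].
- move=> I X [B0 bB0 IB0] IX XE.
  have YE : ground M `\` X `<=` ground M by move=> y [].
  have [L [[iL _ LX] maxL]] :=
    indep_maximal matM (indep_set0 matM) (@sub0set _ _) YE.
  have [B [bB LB BI]] :
      exists B, [/\ base M B, L `<=` B & B `<=` ground M `\` I].
    apply: (base_extend bB0) => //.
    + move=> y B0y; split; first exact: base_ground B0y.
      by move=> /IB0 [].
    + by move=> y /LX [Ey nXy]; split=> // /IX.
  exists (X `\` B); split.
    split; last by move=> y [].
      by exists B => // y [Xy nBy]; split=> //; apply: XE.
    by move=> y Iy; split; [exact: IX|move=> /BI []].
  move=> J [[B' bB' JB'] IJ JX] XBJ; apply/seteqP; split=> // y Jy.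
  split; first exact: JX.
  move=> By.
  (* L with the trace of B' on X lies properly inside B, so it could be
     augmented from B' by an element outside X, against the choice of L. *)
  pose N := L `|` (B' `&` X).
  have NB : N `<=` B.
    move=> z [/LB//|[B'z Xz]]; apply: contrapT => nBz.
    by have [] := JB' z (XBJ z (conj Xz nBz)).
  have nNy : ~ N y.
    move=> [/LX[_]|[B'y _]]; first by apply; exact: JX.
    by have [] := JB' y Jy.
  have iN : indep M N by apply: (indep_sub matM) (base_indep bB) _.
  have [|w [[B'w nNw] iNw]] := indep_augment matM iN _ bB'.
    exact: (not_maximal_sub (base_indep bB) NB By).
  have nXw : ~ X w by move=> Xw; apply: nNw; right.
  apply: nNw; left; rewrite -(maxL (L `|` [set w])); first by right.
    split=> //.
      by apply: (indep_sub matM) iNw _ => z [Lz|->]; [left; left|right].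
    by move=> z [/LX//|->]; split=> //; apply: base_ground B'w.
  by move=> z; left.
Qed.

Lemma dual_dual : dual (dual M) = M.
Proof.
suff iE : indep (dual (dual M)) = indep M.
  by case: M iE => E F; apply: (congr1 (SetSys E)).
apply/seteqP; split=> I.
  move=> [X /base_dual[B bB ->] IX].
  apply: (indep_sub matM) (base_indep bB) _ => y /IX [Ey].
  by move=> nEB; apply: contrapT => nBy; apply: nEB.
move=> /indep_in_base[B bB IB]; exists (ground M `\` B).
  by apply/base_dual; exists B.
move=> y /IB By; split; first exact: base_ground By.
by case.
Qed.

(** * Circuits against cocircuits *)

Lemma circuit_sub_indep (C Y : set T) x :
  circuit M C -> Y `<=` C -> C x -> ~ Y x -> indep M Y.
Proof.
move=> [[CE _] minC] YC Cx nYx; apply: contrapT => dY; apply: nYx.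
by rewrite (minC Y) //; split=> // y /YC /CE.
Qed.

Lemma base_mem_indep (B : set T) x : base M B -> indep M (B `|` [set x]) -> B x.
Proof.
by move=> [_ maxB] iBx; rewrite -(maxB _ iBx) //; right.
Qed.

Lemma circuit_indep (C : set T) : circuit M C -> ~ indep M C.
Proof. by case=> [[]]. Qed.

Lemma circuit_ground (C : set T) : circuit M C -> C `<=` ground M.
Proof. by case=> [[]]. Qed.

Lemma cocircuit_ground (D : set T) : cocircuit M D -> D `<=` ground M.
Proof. by case=> [[]]. Qed.

Lemma cocircuit_meets_base (D B : set T) :
  cocircuit M D -> base M B -> exists x, B x /\ D x.
Proof.
move=> [[DE dD] _] bB; apply: contrapT => nex; apply: dD; exists B => // y Dy.
by split; [exact: DE|move=> By; apply: nex; exists y].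
Qed.

Lemma cocircuit_base (D : set T) x :
  cocircuit M D -> D x ->
  exists B, [/\ base M B, B x & forall y, B y -> D y -> y = x].
Proof.
move=> cD Dx.
have [B bB DB] : indep (dual M) (D `\ x).
  apply: contrapT => dDx; have [_ minD] := cD.
  have : (D `\ x) x.
    rewrite (minD (D `\ x)) //.
    by split=> // y [Dy _]; apply: cocircuit_ground cD _ Dy.
  by move=> [_ /(_ erefl)].
have BDx y : B y -> D y -> y = x.
  by move=> By Dy; apply: contrapT => nyx; have [] := DB y (conj Dy nyx).
exists B; split=> //; have [y [By Dy]] := cocircuit_meets_base cD bB.
by rewrite -(BDx y By Dy).
Qed.

(** The independent set C - e extends to a base J inside the complement of D
    together with e. Since J must meet D, it contains e and hence C. *)
Lemma circuit_cocircuit_not_singleton (C D : set T) e :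
  circuit M C -> cocircuit M D -> C `&` D <> [set e].
Proof.
move=> cC cD CDe; have [Ce De] : (C `&` D) e by rewrite CDe.
have [B [bB Be BDe]] := cocircuit_base cD De.
pose X := [set y | ground M y /\ (D y -> y = e)].
have iCe : indep M (C `\ e).
  by apply: (circuit_sub_indep cC _ Ce) => [y []|[_ /(_ erefl)]].
have [J [bJ CJ JX]] : exists J, [/\ base M J, C `\ e `<=` J & J `<=` X].
  apply: (base_extend bB) => // [y By|y []//|y [Cy nye]].
  - by split; [exact: (base_ground bB)|exact: BDe].
  - split; first exact: circuit_ground cC _ Cy.
    move=> Dy; have : (C `&` D) y by [].
    by rewrite CDe.
have [y [Jy Dy]] := cocircuit_meets_base cD bJ.
apply: (circuit_indep cC); apply: (indep_sub matM) (base_indep bJ) _ => z Cz.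
have [->|nze] := EM (z = e); last by apply: CJ.
by have [_ <-] := JX y Jy.
Qed.

(** Take the fundamental circuit of y with respect to a base that meets D in x
    only; it contains x, for otherwise it would meet D in y alone. *)
Lemma circuit_meeting_cocircuit_in_two (D : set T) x y :
  cocircuit M D -> D x -> D y -> y <> x ->
  exists C, [/\ circuit M C, C y, C x &
                forall z, C z -> D z -> z = x \/ z = y].
Proof.
move=> cD Dx Dy nyx; have [B [bB Bx BDx]] := cocircuit_base cD Dx.
have [|iBy|C [cC CBy Cy]] := @fundamental_circuit B y (base_indep bB).
- exact: cocircuit_ground cD _ Dy.
- by apply: nyx; apply: BDx => //; apply: base_mem_indep iBy.
have CD z : C z -> D z -> z = x \/ z = y.
  by move=> /CBy[Bz|->] Dz; [left; apply: BDx|right].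
exists C; split=> //; apply: contrapT => nCx.
apply: (circuit_cocircuit_not_singleton (e := y) cC cD).
apply/seteqP; split=> z.
  move=> [Cz Dz]; case: (CD z Cz Dz) => // zx.
  by case: nCx; rewrite -zx.
by move=> ->.
Qed.

(** * Deletion *)

(** Augmentation is the delicate axiom. If I cannot be augmented from J, then I
    extends to a base I' of M all of whose further elements lie in D. As I is
    not maximal outside D, one of those elements can be exchanged for some z
    outside D. The resulting base B3 has too few elements in D to be compatible
    with J being maximal outside D. *)
Lemma deletion_is_matroid (D : set T) : is_matroid (deletion M D).
Proof.
split.
- by move=> I [].
- by split; [exact: indep_set0|exact: sub0set].
- move=> I J [iJ JX] IJ; split; first exact: (indep_sub matM) iJ IJ.
  exact: subset_trans JX.
- move=> I J [iI IX] nmaxI [[iJ JX] maxJ].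
  have maxJ' x : ground M x -> ~ D x -> indep M (J `|` [set x]) -> J x.
    move=> Ex nDx iJx; rewrite -(maxJ (J `|` [set x])); first by right.
      by split=> // y [/JX|->].
    by move=> y; left.
  have [K [[iK KX] IK [z [Kz nIz]]]] : exists K,
      [/\ indep (deletion M D) K, I `<=` K & exists z, K z /\ ~ I z].
    apply: contrapT => nex; apply: nmaxI; split=> // K iK IK.
    apply/seteqP; split=> // z Kz; apply: contrapT => nIz; apply: nex.
    by exists K; split=> //; exists z.
  have [Ez nDz] := KX z Kz.
  have [B bB JB] := indep_in_base iJ.
  have BXJ x : B x -> ~ D x -> J x.
    move=> Bx nDx; apply: maxJ' => //; first exact: base_ground Bx.
    by apply: (indep_sub matM) (base_indep bB) _ => y [/JB|->].
  have [I' [bI' II' I'IB]] :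
      exists J, [/\ base M J, I `<=` J & J `<=` I `|` B].
    apply: (base_extend bB) => // y [/IX[]//|]; exact: base_ground.
  apply: contrapT => nex.
  have noaug x : J x -> ~ I x -> ~ indep M (I `|` [set x]).
    move=> Jx nIx iIx; apply: nex; exists x; split=> //; split=> //.
    by move=> y [/IX//|->]; exact: JX.
  have I'z : ~ I' z.
    move=> I'z; case: (I'IB z I'z) => // Bz.
    apply: (@noaug z) => //; first exact: BXJ.
    by apply: (indep_sub matM) iK _ => y [/IK|->].
  have iIz : indep M (I `|` [set z]).
    by apply: (indep_sub matM) iK _ => y [/IK|->].
  have [B3 [bB3 IzB3 B3I']] : exists J,
      [/\ base M J, I `|` [set z] `<=` J & J `<=` I' `|` [set z]].
    apply: (base_extend bI') => //.
      by move=> y [/(base_ground bI')|->].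
    by move=> y [/II'|->]; [left|right].
  have [w [I'w nB3w]] : exists w, I' w /\ ~ B3 w.
    apply: contrapT => nex'; apply: I'z; apply: (base_mem_indep bI').
    apply: (indep_sub matM) (base_indep bB3) _ => y [I'y|->].
      by apply: contrapT => nB3y; apply: nex'; exists y.
    by apply: IzB3; right.
  have nIw : ~ I w by move=> Iw; apply/nB3w/IzB3; left.
  have Bw : B w by case: (I'IB w I'w).
  have nJw : ~ J w.
    move=> Jw; apply: (noaug _ Jw nIw).
    by apply: (indep_sub matM) (base_indep bI') _ => y [/II'|->].
  (* B3 meets D inside B - w, so J with this trace is properly inside B. *)
  pose N := J `|` (B3 `&` D).
  have NB : N `<=` B.
    move=> y [/JB//|[/B3I' [/I'IB[/IX[]//|//]|->//]]].
  have nNw : ~ N w by move=> [|[]].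
  have iN : indep M N by apply: (indep_sub matM) (base_indep bB) _.
  have [|x [[B3x nNx] iNx]] := indep_augment matM iN _ bB3.
    exact: (not_maximal_sub (base_indep bB) NB Bw).
  have nDx : ~ D x by move=> Dx; apply: nNx; right.
  apply: nNx; left; apply: maxJ' => //; first exact: base_ground B3x.
  by apply: (indep_sub matM) iNx _ => y [Jy|->]; [left; left|right].
- move=> I X [iI IX] IsX XE.
  have [|J [[iJ IJ JX] maxJ]] := indep_maximal matM iI IsX.
    by move=> y /XE [].
  exists J; split; first by split=> //; split=> // y /JX /XE.
  by move=> Y [[iY _] IY YX]; apply: maxJ.
Qed.

End MatroidTheory.

(** Let L be a maximal coindependent subset of D. Every base of M avoiding L
    meets the complement of D in a base of the deletion, so d together with L is
    codependent, although removing any point of d makes it coindependent. Hence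
    a cocircuit of M inside their union must contain all of d. *)
Lemma cocircuit_deletion_lift (T : Type) (M : setsys T) (D d : set T) :
  is_matroid M ->
  cocircuit (deletion M D) d -> exists2 b, cocircuit M b & d `<=` b.
Proof.
move=> matM cd; have matN := dual_is_matroid matM.
pose X := ground M `\` D.
have dX : d `<=` X by case: cd => [[]].
have [L [[[B0 bB0 LB0] _ LD] maxL]] := indep_maximal matN
  (indep_set0 matN) (@sub0set _ (D `&` ground M)) (@subIsetr _ _ _).
have codep : ~ indep (dual M) (d `|` L).
  move=> [B bB dLB]; have [[_ dd] _] := cd; apply: dd.
  exists (B `&` X).
    split; first by split; [apply: (indep_sub matM) (base_indep bB) _|];
      move=> y [].
    move=> Y [iY YX] BY; apply/seteqP; split=> // x Yx; split; last exact: YX.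
    have [Ex nDx] := YX x Yx.
    apply: contrapT => nBx.
    have iBx : indep M ((B `&` X) `|` [set x]).
      by apply: (indep_sub matM) iY _ => y [/BY|->].
    have [J [bJ BxJ JBx]] : exists J,
        [/\ base M J, (B `&` X) `|` [set x] `<=` J & J `<=` B `|` [set x]].
      apply: (base_extend matM bB) => // [y [/(base_ground matM bB)|->]//|].
      by move=> y [[]|]; [left|right].
    have [y [By nJy]] : exists y, B y /\ ~ J y.
      apply: contrapT => nex; apply/nBx/(base_mem_indep bB).
      apply: (indep_sub matM) (base_indep bJ) _ => y [By|->].
        by apply: contrapT => nJy; apply: nex; exists y.
      by apply: BxJ; right.
    have Ey := base_ground matM bB By.
    have Dy : D y.
      by apply: contrapT => nDy; apply/nJy/BxJ; left.
    have Ly : L y.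
      rewrite -(maxL (L `|` [set y])); [by right| |by move=> z; left].
      split=> // [|z [/LD|->]//]; exists J => // z [Lz|->//].
      have [Dz Ez] := LD z Lz; split=> // Jz.
      case: (JBx z Jz) => [Bz|zx]; last by apply: nDx; rewrite -zx.
      by have [] := dLB z (or_intror Lz).
    by have [] := dLB y (or_intror Ly).
  move=> y dy; have [Ey nDy] := dX y dy; split=> // -[By _].
  by have [] := dLB y (or_introl dy).
have [|b cb bdL] := dependent_circuit matN _ codep.
  by move=> y [/dX[]|/LD[]].
exists b => // e de; apply: contrapT => nbe.
have [J [bJ Je Jd]] := cocircuit_base cd de.
have [[iJ JX] maxJ] := bJ.
have [B [bB JB BJD]] : exists B,
    [/\ base M B, J `<=` B & B `<=` ground M `\` L].
  apply: (base_extend matM bB0) => //.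
  - by move=> y B0y; split; [exact: (base_ground matM bB0)|move=> /LB0[]].
  - by move=> y /JX [Ey nDy]; split=> // /LD [].
apply: (circuit_indep cb); exists B => // y by_.
split; first exact: circuit_ground cb _ by_.
have [dy|Ly] := bdL y by_; last by move=> /BJD [].
move=> By; apply: nbe; rewrite -(Jd y _ dy) //.
have BJ : J = B `&` X.
  apply/esym/maxJ.
    by split=> [|z []//]; apply: (indep_sub matM) (base_indep bB) _ => z [].
  by move=> z Jz; split; [exact: JB|exact: JX].
by rewrite BJ; split=> //; apply: dX.
Qed.

(** * Orthogonality *)

Section Orthogonality.
Variables (k : fieldType) (T : choiceType) (E : set T).
Local Open Scope ring_scope.
Implicit Types (c d : T -> k) (S : set T).

(** The sum over an infinite support is zero by convention, hence the separate
    finiteness condition. *)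
Definition orth c d :=
  finite_set [set e | E e /\ c e * d e <> 0] /\
  \sum_(e \in E) (c e * d e) = 0.

Lemma fsum_seq (F : T -> k) (r : seq T) :
  uniq r -> (forall e, e \in r -> E e) ->
  (forall e, E e -> F e <> 0 -> e \in r) ->
  \sum_(e \in E) F e = \sum_(e <- r) F e.
Proof.
move=> ur rE Fr; rewrite (fsbigE r) //; last first.
  by move=> e Ee; apply: contraNeq => /eqP; apply: Fr.
rewrite big_seq_cond [RHS]big_seq_cond; apply: eq_bigl => e.
by rewrite andbT; apply: andb_idr => /rE; rewrite inE.
Qed.

Lemma orth_seqP c d (r : seq T) :
  uniq r -> (forall e, e \in r -> E e) ->
  (forall e, E e -> c e * d e <> 0 -> e \in r) ->
  orth c d <-> \sum_(e <- r) c e * d e = 0.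
Proof.
move=> ur rE cdr; rewrite /orth (fsum_seq ur rE cdr); split=> [[]//|sum0].
split=> //; apply: (sub_finite_set _ (finite_seq r)) => e [Ee ne0].
exact: cdr.
Qed.

Lemma orth_sym c d : orth c d -> orth d c.
Proof.
have cdE : (fun e => c e * d e) = (fun e => d e * c e).
  by apply/funext => e; rewrite mulrC.
by rewrite /orth -(congr1 (fun F => \sum_(e \in E) F e) cdE) => -[fin ->];
  split=> //; apply: (sub_finite_set _ fin) => e [Ee]; rewrite mulrC.
Qed.

Lemma finite_setP_seq S : finite_set S ->
  exists2 r : seq T, uniq r & forall e, (e \in r) <-> S e.
Proof.
move=> /finite_seqP[s ->]; exists (undup s); first exact: undup_uniq.
by move=> e; rewrite mem_undup.
Qed.

Lemma orth_comb (a : k) c1 c2 d :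
  orth c1 d -> orth c2 d -> orth (fun e => c1 e + a * c2 e) d.
Proof.
move=> o1 o2; have [fin1 _] := o1; have [fin2 _] := o2.
have /finite_setP_seq[r ur rP] : finite_set
    ([set e | E e /\ c1 e * d e <> 0] `|` [set e | E e /\ c2 e * d e <> 0]).
  by rewrite finite_setU.
have rE e : e \in r -> E e by move=> /rP[[]|[]].
have r1 e : E e -> c1 e * d e <> 0 -> e \in r by move=> *; apply/rP; left.
have r2 e : E e -> c2 e * d e <> 0 -> e \in r by move=> *; apply/rP; right.
apply/(orth_seqP ur rE) => [e Ee ne0|].
  have [z1|] := EM (c1 e * d e = 0); last exact: r1.
  have [z2|] := EM (c2 e * d e = 0); last exact: r2.
  by case: ne0; rewrite mulrDl -mulrA z1 z2 mulr0 addr0.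
under eq_bigr do rewrite mulrDl -mulrA.
by rewrite big_split /= -mulr_sumr ((orth_seqP ur rE r1).1 o1)
  ((orth_seqP ur rE r2).1 o2) mulr0 addr0.
Qed.

Definition comb_closed (Phi : set (T -> k)) :=
  forall a c1 c2, Phi c1 -> Phi c2 -> Phi (fun e => c1 e + a * c2 e).

Lemma comb_closed_sum (Phi : set (T -> k)) (I : eqType) (s : seq I)
    (a : I -> k) (F : I -> T -> k) c :
  comb_closed Phi -> Phi c -> (forall i, i \in s -> Phi (F i)) ->
  Phi (fun e => c e + \sum_(i <- s) a i * F i e).
Proof.
move=> Phicl; elim: s c => [|i s IH] c Phic PhiF.
  by under eq_fun do rewrite big_nil addr0.
under eq_fun do rewrite big_cons addrA.
apply: IH => [|j js]; last by apply: PhiF; rewrite inE js orbT.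
by apply: Phicl => //; apply: PhiF; rewrite mem_head.
Qed.

(** Think of the elements of Phi as vectors restricted to S. By the second
    hypothesis they reduce every finitely supported vector to a multiple of the
    unit vector at e0, and by the first this multiple is unique. It is the
    wanted functional: with g x the vector of Phi that is 1 at x and zero on the
    rest of S except at e0, the unit vector at x reduces to - g x e0 times the one
    at e0. *)
Lemma separating_functional (Phi : set (T -> k)) S e0 :
  comb_closed Phi -> S `<=` E -> S e0 ->
  (forall c, Phi c -> (forall y, S y -> y <> e0 -> c y = 0) -> c e0 = 0) ->
  (forall x, S x -> x <> e0 -> exists c,
     [/\ Phi c, c x <> 0 & forall y, S y -> y <> e0 -> y <> x -> c y = 0]) ->
  exists d, [/\ forall e, ~ S e -> d e = 0, d e0 = 1 &
    forall c, Phi c -> finite_set [set e | S e /\ c e <> 0] -> orth c d].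
Proof.
move=> Phicl SE Se0 noPhi exPhi.
have /choice[g gP] x : exists c, S x -> x <> e0 ->
    [/\ Phi c, c x = 1 & forall y, S y -> y <> e0 -> y <> x -> c y = 0].
  have [[Sx nxe0]|nSx] := EM (S x /\ x <> e0); last first.
    by exists (fun=> 0) => Sx nx; case: nSx.
  have [c [Phic cx c0]] := exPhi x Sx nxe0.
  (* c + a c is c normalised to the value 1 at x. *)
  pose a := (c x)^-1 - 1.
  exists (fun e => c e + a * c e) => _ _; split.
  - exact: Phicl.
  - by rewrite mulrBl mul1r addrC subrK mulVf //; apply/eqP.
  - by move=> y Sy ny nyx; rewrite c0 // mulr0 addr0.
pose d e : k := if `[< S e >] then if e == e0 then 1 else - g e e0 else 0.
exists d; split=> [e nSe||c Phic finc].
- by rewrite /d asboolF.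
- by rewrite /d eqxx asboolT.
have [r ur rP] := finite_setP_seq finc.
pose s := filter (predC1 e0) r.
have us : uniq s by rewrite filter_uniq.
have sP e : e \in s -> [/\ S e, e <> e0 & c e <> 0].
  by rewrite mem_filter => /andP[/eqP ne /rP[]].
have e0s : e0 \notin s by rewrite mem_filter /= eqxx.
(* Subtracting the vectors c x * g x clears c on S except at e0. *)
have ce0 : c e0 + \sum_(x <- s) - c x * g x e0 = 0.
  apply: (noPhi (fun e => c e + \sum_(x <- s) - c x * g x e)).
    by apply: comb_closed_sum => // x /sP[Sx nx _]; case: (gP x Sx nx).
  move=> y Sy ny; have [ys|ys] := boolP (y \in s).
    rewrite (bigD1_seq y) //= big1_seq => [|x /andP[nxy /sP[Sx nx _]]].
      by have [_ -> _] := gP y Sy ny; rewrite addr0 mulr1 subrr.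
    have [_ _ ->] := gP x Sx nx; rewrite ?mulr0 //.
    by apply/eqP; rewrite eq_sym.
  rewrite big1_seq => [|x /= xs].
    rewrite addr0; apply: contrapT => ncy; move: ys.
    rewrite mem_filter /=; case/negP; apply/andP.
    by split; [apply/eqP|apply/rP].
  have [Sx nx _] := sP x xs; have [_ _ ->] := gP x Sx nx; rewrite ?mulr0 //.
  by move=> yx; move: ys; rewrite yx xs.
apply/(orth_seqP (r := e0 :: s)).
- by rewrite /= e0s.
- by move=> e; rewrite inE => /predU1P[->|/sP[/SE]]; first exact: SE.
- move=> e _ ne0; rewrite inE mem_filter /=; have [//|ne] := eqVneq e e0.
  apply/rP; split.
    apply: contrapT => nSe; apply: ne0.
    by rewrite /d asboolF // mulr0.
  by move=> ce; apply: ne0; rewrite ce mul0r.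
rewrite big_cons {1}/d eqxx asboolT // mulr1 -[RHS]ce0; congr (_ + _).
apply: eq_big_seq => x /sP[Sx nx _].
by rewrite /d asboolT // (introF eqP nx) mulrN mulNr.
Qed.

End Orthogonality.

(** * Thin dependences and circuits *)

Section ThinSums.
Variables (k : fieldType) (T : choiceType) (E : set T).
Local Open Scope ring_scope.
Variables (A : Type) (f : T -> A -> k).
Implicit Types c d : T -> k.

Lemma thin_dependence_comb : comb_closed (thin_dependence E f).
Proof.
move=> a c1 c2 [z1 o1] [z2 o2]; split=> [e nEe|i].
  by rewrite z1 // z2 // mulr0 addr0.
exact: (orth_comb a (o1 i) (o2 i)).
Qed.

Lemma thin_dependence_dependent c (X : set T) e :
  thin_dependence E f c -> c e <> 0 -> (forall y, ~ X y -> c y = 0) ->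
  ~ indep (thin_sums E f) X.
Proof. by move=> tc ce cX [_]; apply; exists c; split=> //; exists e. Qed.

Lemma dependent_thin_dependence (X : set T) :
  X `<=` E -> ~ indep (thin_sums E f) X ->
  exists c, [/\ thin_dependence E f c, exists e, c e <> 0
              & forall y, ~ X y -> c y = 0].
Proof. by move=> XE dX; apply: contrapT => nex; apply: dX; split. Qed.

Lemma circuit_thin_dependence (C : set T) : circuit (thin_sums E f) C ->
  exists2 c, thin_dependence E f c & forall e, C e <-> c e <> 0.
Proof.
move=> [[CE dC] minC].
have [c [tc [e ce] cC]] := dependent_thin_dependence CE dC.
exists c => // y; have CP z : c z <> 0 -> C z.
  by move=> cz; apply: contrapT => /cC.
split; last exact: CP.
rewrite -{1}(minC [set z | c z <> 0]) //; split=> [z /CP /CE//|].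
by apply: (thin_dependence_dependent tc ce) => z; apply: contrapT.
Qed.

(** Within the support K of c the coordinates of f are finitely supported, which
    makes supports that are minimal through e0 exist. Phi is the space of
    functionals that vanish on the thin dependences within K. By linear duality,
    Z satisfies P exactly when some thin dependence that is nonzero at e0 is
    supported on K minus Z together with e0; but P only involves finitely many
    points of Z at a time, so that unions of chains satisfy it. *)
Lemma circuit_in_support c e0 : thin_dependence E f c -> c e0 <> 0 ->
  exists C, [/\ circuit (thin_sums E f) C, C e0 & forall e, C e -> c e <> 0].
Proof.
move=> tc ce0; have [cE _] := tc.
pose K := [set e | c e <> 0].
have KE : K `<=` E by move=> e Ke; apply: contrapT => /cE.
pose Phi := [set p : T -> k | forall c', thin_dependence E f c' ->
  (forall e, ~ K e -> c' e = 0) -> orth E p c'].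
have Phicl : comb_closed Phi.
  by move=> a p1 p2 P1 P2 c' tc' c'K; apply: orth_comb; [exact: P1|exact: P2].
have Phifin p : Phi p -> finite_set [set e | K e /\ p e <> 0].
  move=> Pp; have [fin _] : orth E p c by apply: Pp => // e /contrapT.
  apply: (sub_finite_set _ fin) => e [Ke pe]; split; first exact: KE.
  by apply/eqP; rewrite mulf_neq0 //; apply/eqP.
pose P := [set Z : set T | forall p, Phi p ->
  (forall y, K y -> ~ Z y -> y <> e0 -> p y = 0) -> p e0 = 0].
have [Z [PZ maxZ]] : exists Z, P Z /\ forall Z', Z `<` Z' -> ~ P Z'.
  apply: Zorn_bigcup => F FP chF p Pp p0.
  have [s us sP] := finite_setP_seq (Phifin p Pp).
  have [Z [FZ Zs]] : exists Z, (F Z \/ Z = set0) /\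
      forall y, y \in s -> y <> e0 -> Z y.
    have : forall y, y \in s -> y <> e0 -> exists2 Z, F Z & Z y.
      move=> y /sP[Ky py] ny; apply: contrapT => nex; apply: py.
      by apply: p0 => // -[Z FZ Zy]; apply: nex; exists Z.
    elim: s {us sP} => [|x s IH] Fs; first by exists set0; split; [right|].
    have [|Z [FZ Zs]] := IH.
      by move=> y ys; apply: Fs; rewrite inE ys orbT.
    have [->|nx] := EM (x = e0).
      by exists Z; split=> // y; rewrite inE => /predU1P[//|]; exact: Zs.
    have [Z' FZ' Z'x] := Fs x (mem_head _ _) nx.
    have [ZZ'|Z'Z] : Z `<=` Z' \/ Z' `<=` Z.
      by case: FZ => [FZ|->]; [exact: chF|left].
      exists Z'; split; first by left.
      by move=> y; rewrite inE => /predU1P[->//|ys ny]; apply/ZZ'/Zs.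
    exists Z; split=> // y; rewrite inE => /predU1P[-> _|]; last exact: Zs.
    exact: Z'Z.
  have p0' y : K y -> ~ Z y -> y <> e0 -> p y = 0.
    move=> Ky nZy ny; apply: contrapT => py; apply/nZy/Zs => //.
    by apply/sP.
  case: FZ => [/FP PZ|Z0]; first exact: PZ.
  (* In the empty case p vanishes on K except at e0 but is orthogonal to c. *)
  have o : orth E p c by apply: Pp => // e /contrapT.
  have : p e0 * c e0 = 0.
    have := (orth_seqP (r := [:: e0]) _ _ _).1 o; rewrite big_seq1; apply=> //.
      by move=> e; rewrite inE => /eqP ->; apply: KE.
    move=> e Ee pce; rewrite inE; apply/negPn/negP => /eqP ne; apply: pce.
    have [ce|Ke] := EM (c e = 0); first by rewrite ce mulr0.
    by rewrite p0' ?mul0r // Z0.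
  by move=> /eqP; rewrite mulf_eq0 => /orP[/eqP//|/eqP].
(* By maximality of Z, every point x of S other than e0 is tied to e0 by a
   functional that vanishes on the rest of S. *)
pose S := [set e | K e /\ ~ Z e \/ e = e0].
have SK : S `<=` K by move=> e [[]//|->].
have noPhi p : Phi p -> (forall y, S y -> y <> e0 -> p y = 0) -> p e0 = 0.
  by move=> Pp p0; apply: PZ => // y Ky nZy; apply: p0; left.
have exPhi x : S x -> x <> e0 -> exists p, [/\ Phi p, p e0 <> 0, p x <> 0 &
    forall y, S y -> y <> e0 -> y <> x -> p y = 0].
  move=> [[Kx nZx]|//] nx; have : ~ P (Z `|` [set x]).
    apply: maxZ; split; first by move=> y; left.
    by move=> /(_ x (or_intror erefl)).
  move=> nP; apply: contrapT => nex; apply: nP => p Pp p0.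
  apply: contrapT => pe0; apply: nex; exists p.
  have p0' y : S y -> y <> e0 -> y <> x -> p y = 0.
    by move=> [[Ky nZy]|//] ny nyx; apply: p0 => // -[].
  split=> // px; apply/pe0/noPhi => // y Sy ny.
  by have [->|nyx] := EM (y = x); [exact: px|exact: p0'].
have [d [dS de0 dPhi]] : exists d, [/\ forall e, ~ S e -> d e = 0, d e0 = 1 &
    forall p, Phi p -> finite_set [set e | S e /\ p e <> 0] -> orth E p d].
  apply: separating_functional => //; first exact: subset_trans KE.
    by right.
  move=> x Sx nx; have [p [Pp pe0 px p0]] := exPhi x Sx nx.
  by exists p; split.
have td : thin_dependence E f d.
  split=> [e nEe|a]; first by apply: dS => /SK /KE.
  apply/orth_sym/dPhi; first by move=> c' [_ oc'] _; apply/orth_sym/oc'.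
  have Pa : Phi (f^~ a) by move=> c' [_ oc'] _; apply/orth_sym/oc'.
  by apply: (sub_finite_set _ (Phifin _ Pa)) => e [/SK].
exists S; split; [|by right|by []].
split; first split.
- by move=> e /SK /KE.
- apply: (thin_dependence_dependent td (e := e0)) => //; rewrite de0.
  exact/eqP/oner_neq0.
move=> Y [YE dY] YS; apply/seteqP; split=> // x Sx.
have [c' [tc' [z c'z] c'Y]] := dependent_thin_dependence YE dY.
have YP y : c' y <> 0 -> Y y by move=> c'y; apply: contrapT => /c'Y.
apply: (YP).
have c'S y : ~ S y -> c' y = 0 by move=> nSy; apply: c'Y => /YS.
(* Hence a thin dependence supported in S is nonzero either everywhere on S or
   nowhere. *)
have pair y : S y -> y <> e0 -> exists p, [/\ p e0 <> 0, p y <> 0 &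
    p y * c' y + p e0 * c' e0 = 0].
  move=> Sy ny; have [p [Pp pe0 py p0]] := exPhi y Sy ny.
  exists p; split=> //.
  have o : orth E p c' by apply: Pp => // e nKe; apply: c'S => /SK.
  have := (orth_seqP (r := [:: y; e0]) _ _ _).1 o.
  rewrite big_cons big_seq1; apply=> [|e|e _ pce].
  - by rewrite /= inE andbT; apply/eqP.
  - by rewrite !inE => /orP[/eqP->|/eqP->]; apply/KE => //; apply: SK.
  - rewrite !inE; apply/negPn; rewrite negb_or.
    apply/negP => /andP[/eqP ney /eqP ne].
    apply: pce; have [Se|nSe] := EM (S e); last by rewrite c'S ?mulr0.
    by rewrite p0 ?mul0r.
have c'e0 : c' e0 <> 0.
  move=> c'e0; apply: (c'z).
  have [->//|nz] := EM (z = e0).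
  have [p [_ pz]] := pair z (YS z (YP z c'z)) nz.
  by rewrite c'e0 mulr0 addr0 => /eqP; rewrite mulf_eq0 => /orP[/eqP|/eqP].
have [->//|nx] := EM (x = e0); have [p [pe0 px pr]] := pair x Sx nx.
move=> c'x; move: pr; rewrite c'x mulr0 add0r => /eqP.
by rewrite mulf_eq0 => /orP[/eqP|/eqP].
Qed.

End ThinSums.

(** * Duality and minors of tame thin sums matroids *)

Section Duality.
Variables (k : fieldType) (T : choiceType).
Local Open Scope ring_scope.

Lemma cocircuit_orthogonal (M : setsys T) (A : Type) (f : T -> A -> k)
    (D : set T) :
  is_matroid M -> tame M -> M = thin_sums (ground M) f -> cocircuit M D ->
  exists d : T -> k, [/\ forall e, ~ D e -> d e = 0, exists e, d e <> 0 &
    forall c, thin_dependence (ground M) f c ->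
      circuit M [set e | c e <> 0] -> orth (ground M) c d].
Proof.
move=> matM tameM Mf cD.
have DE := cocircuit_ground cD.
have [e0 De0] : exists e, D e.
  have [B bB] := exists_base matM.
  by have [e [_ De]] := cocircuit_meets_base cD bB; exists e.
have [d [dD de0 dP]] : exists d : T -> k, [/\ forall e, ~ D e -> d e = 0,
    d e0 = 1 & forall c, thin_dependence (ground M) f c ->
      finite_set [set e | D e /\ c e <> 0] -> orth (ground M) c d].
  apply: separating_functional => //; first exact: thin_dependence_comb.
    move=> c tc cD0; apply: contrapT => ce0.
    have [C [cC Ce0 Cc]] := circuit_in_support tc ce0.
    rewrite -Mf in cC.
    apply: (circuit_cocircuit_not_singleton (e := e0) matM cC cD).
    apply/seteqP; split=> [e [Ce De]|_ ->//].
    by apply: contrapT => ne; apply: (Cc e Ce); apply: cD0.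
  move=> x Dx nx.
  have [C [cC Cx Ce0 CD]] := circuit_meeting_cocircuit_in_two matM cD De0 Dx nx.
  rewrite Mf in cC; have [c tc Cc] := circuit_thin_dependence cC.
  exists c; split=> //; first exact/Cc.
  move=> y Dy ny nyx; apply: contrapT => /Cc Cy.
  by have [|] := CD y Cy Dy.
exists d; split=> //; first by exists e0; rewrite de0; apply/eqP/oner_neq0.
move=> c tc cC; apply: dP => //; apply: (sub_finite_set _ (tameM _ _ cC cD)).
by move=> e [].
Qed.

(** The representing family is indexed by all vectors c, with a zero coordinate
    when c is not a thin dependence supported exactly on a circuit. *)
Lemma thin_sums_dual (M : setsys T) :
  thin_sums_matroid k M -> tame M -> thin_sums_matroid k (dual M).
Proof.
move=> [matM [A [f Mf]]] tameM; split; first exact: dual_is_matroid.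
pose good c := thin_dependence (ground M) f c /\ circuit M [set e | c e <> 0].
pose g (e : T) (c : T -> k) : k := if `[< good c >] then c e else 0.
exists (T -> k), g; congr SetSys; apply/seteqP; split=> I.
  move=> [B bB IB]; split; first by move=> e /IB [].
  move=> [d [[dE dg] [e de] dI]].
  have Ie : I e by apply: contrapT => /dI.
  have [Ee nBe] := IB e Ie.
  have [|C [cC CBe Ce]] :=
    @fundamental_circuit _ M matM B e (base_indep bB) Ee.
    by move=> iBe; apply/nBe/(base_mem_indep bB).
  have [c tc Cc] : exists2 c, thin_dependence (ground M) f c &
      forall y, C y <-> c y <> 0.
    by apply: circuit_thin_dependence; rewrite -Mf.
  have gc : good c.
    split=> //; suff <- : C = [set y | c y <> 0] by [].
    by apply/seteqP; split=> y /Cc.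
  have o : orth (ground M) d c.
    suff <- : g^~ c = c by apply: dg.
    by apply/funext => y; rewrite /g asboolT.
  have := (orth_seqP (r := [:: e]) _ _ _).1 o; rewrite big_seq1 => z.
  have /eqP : d e * c e = 0.
    apply: z => // [y|y _ dc]; rewrite inE; first by move=> /eqP ->.
    apply/negPn/negP => /eqP ne; apply: dc.
    have [/CBe[By|//]|nCy] := EM (C y).
      by rewrite dI ?mul0r // => /IB [].
    suff -> : c y = 0 by rewrite mulr0.
    by apply: contrapT => /Cc.
  by rewrite mulf_eq0 => /orP[/eqP//|/eqP]; apply/Cc.
move=> [IE nod]; apply: contrapT => dI; apply: nod.
have [D cD DI] := dependent_circuit (dual_is_matroid matM) IE dI.
have [d [dD dne dP]] := cocircuit_orthogonal matM tameM Mf cD.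
exists d; split=> //; last by move=> e nIe; apply: dD => /DI.
split=> [e nEe|c].
  by apply: dD => /(cocircuit_ground cD).
apply/orth_sym; rewrite /g; have [gc|ngc] := EM (good c).
  suff -> : (fun e => if `[< good c >] then c e else 0) = c.
    by case: gc; apply: dP.
  by apply/funext => e; rewrite asboolT.
suff -> : (fun e => if `[< good c >] then c e else 0) = (fun=> 0).
  by apply/(orth_seqP (r := [::])) => // [e _|]; rewrite ?mul0r // big_nil.
by apply/funext => e; rewrite asboolF.
Qed.

Lemma tame_dual (M : setsys T) : is_matroid M -> tame M -> tame (dual M).
Proof.
move=> matM tameM C D cC; rewrite /cocircuit dual_dual // setIC => cD.
exact: tameM.
Qed.

(** A vector supported outside D is a thin dependence of f over the ground set
    if and only if it is one over the smaller ground set. *)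
Lemma thin_sums_deletion (M : setsys T) (D : set T) :
  thin_sums_matroid k M -> thin_sums_matroid k (deletion M D).
Proof.
move=> [matM [A [f Mf]]]; split; first exact: deletion_is_matroid.
exists A, f; congr SetSys.
have td c (X : set T) : X `<=` ground M `\` D -> (forall e, ~ X e -> c e = 0) ->
    thin_dependence (ground M) f c <-> thin_dependence (ground M `\` D) f c.
  move=> XE cX.
  have suppE a : [set e | ground M e /\ c e * f e a <> 0] =
      [set e | (ground M `\` D) e /\ c e * f e a <> 0].
    apply/seteqP; split=> e [Ee cf]; split=> //; last by case: Ee.
    by apply: XE; apply: contrapT => /cX ce; apply: cf; rewrite ce mul0r.
  have sumE a : \sum_(e \in ground M `\` D) (c e * f e a) =
      \sum_(e \in ground M) (c e * f e a).
    apply: fsbig_widen => [e []//|e [Ee nEDe]] /=.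
    by rewrite cX ?mul0r // => /XE.
  split=> -[_ cf]; split=> [e nEe|a].
  - by apply: cX => /XE.
  - by rewrite -suppE sumE; apply: cf.
  - by apply: cX => /XE [].
  - by rewrite suppE -sumE; apply: cf.
have iE : indep M = indep (thin_sums (ground M) f) by rewrite -Mf.
apply/seteqP; split=> X /=.
  rewrite iE => -[[XE nod] XED]; split=> // -[c [tc cne cX]]; apply: nod.
  by exists c; split=> //; apply/(td c X).
move=> [XED nod]; split=> //; rewrite iE; split; first by move=> e /XED [].
by move=> [c [tc cne cX]]; apply: nod; exists c; split=> //; apply/(td c X).
Qed.

Lemma tame_deletion (M : setsys T) (D : set T) :
  is_matroid M -> tame M -> tame (deletion M D).
Proof.
move=> matM tameM C d [[CE dC] minC] cd.
have [b cb db] := cocircuit_deletion_lift matM cd.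
have cC : circuit M C.
  split; first by split=> [e /CE[]//|iC]; apply: dC.
  move=> Y [YE dY] YC; apply: minC => //; split; first exact: subset_trans CE.
  by move=> [].
by apply: (sub_finite_set _ (tameM _ _ cC cb)) => e [Ce /db].
Qed.

End Duality.

Theorem theorem1p4 (k : fieldType) (T : choiceType) (M : setsys T)
    (Mthin : thin_sums_matroid k M) (Mtame : tame M) :
  (thin_sums_matroid k (dual M) /\ tame (dual M)) /\
  (forall C D : set T,
     C `<=` ground M -> D `<=` ground M -> C `&` D = set0 ->
     thin_sums_matroid k (deletion (contraction M C) D) /\
     tame (deletion (contraction M C) D)).
Proof.
have Dual (N : setsys T) : thin_sums_matroid k N /\ tame N ->
    thin_sums_matroid k (dual N) /\ tame (dual N).
  move=> [tN tameN]; split; first exact: thin_sums_dual.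
  by apply: tame_dual => //; case: tN.
have Deletion (N : setsys T) X : thin_sums_matroid k N /\ tame N ->
    thin_sums_matroid k (deletion N X) /\ tame (deletion N X).
  move=> [tN tameN]; split; first exact: thin_sums_deletion.
  by apply: tame_deletion => //; case: tN.
split=> [|C D _ _ _]; first exact: Dual.
exact/Deletion/Dual/Deletion/Dual.
Qed.
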